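(* Let $f$ be as in the context, for $\varepsilon>0$ let $V_\varepsilon^+$ be the critical front connecting $\alpha$ and $1$ (defined in the context), and let $$H_\alpha(z)=\begin{cases}\alpha & z<0\\ (\alpha+1)/2 & z=0\\ 1 & z>0.\end{cases}$$ Then, as $\varepsilon\to 0^+$, $V_\varepsilon^+(z)\to H_\alpha(z)$ for every $z\in\mathbb{R}$, and the convergence is uniform in $\mathbb{R}\setminus\mathcal{I}_0$ for every neighborhood $\mathcal{I}_0$ of the origin. Moreover, $$(V_\varepsilon^+)'\to(1-\alpha)\,\delta_0\qquad\text{in }\mathcal{D}'(\mathbb{R})\quad\text{as }\varepsilon\to 0^+,$$ where $\delta_0$ is the Dirac delta distribution concentrated at $0$.
   Context: Assumptions on $f$: $f:[0,1]\to\mathbb{R}$ is continuous, $f(0)=f(1)=0$, and there is $\alpha\in(0,1)$ with $f(\alpha)=0$ and $f(s)(s-\alpha)>0$ for every $s\in(0,1)\setminus\{\alpha\}$. Moreover $\int_0^1 f(s)\,ds>0$, the derivative $f'(\alpha)$ exists and is $>0$, and $|f(s)|\le f'(\alpha)|s-\alpha|$ for every $s\in[0,1]$. Finally there is $l>0$ such that $f(s)\ge -ls$ and $f(s)\le l(1-s)$ for every $s\in[0,1]$. Definition of $V_\varepsilon^+$: let $c_\varepsilon^+=2\sqrt{\varepsilon f'(\alpha)}$. It is known that the equation $$\varepsilon\left(\frac{v'}{\sqrt{1+(v')^2}}\right)'-c_\varepsilon^+\,v'+f(v)=0\qquad\text{on }\mathbb{R}$$ has an increasing solution $v\in C^2(\mathbb{R})$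 with $v(-\infty)=\alpha$, $v(+\infty)=1$, unique once the normalization $v(0)=(\alpha+1)/2$ is imposed; this solution is $V_\varepsilon^+$. ($c_\varepsilon^+$ is the smallest nonnegative speed for which such increasing fronts exist.) *)

(* Defs.v *)
From HB Require Import structures.
From mathcomp Require Export all_boot all_order all_algebra.
From mathcomp Require Export all_classical all_reals all_analysis.

Set Implicit Arguments.
Unset Strict Implicit.
Unset Printing Implicit Defensive.

Export Order.TTheory GRing.Theory Num.Theory.
Export numFieldNormedType.Exports.

Local Open Scope ring_scope.
Local Open Scope classical_set_scope.

Section Defs.
Context {R : realType}.
Local Notation mu := (@lebesgue_measure R).

(** A function on [0, 1] is represented by a total function [f : R -> R] that is
    constrained on [0, 1] only. As [0 < alpha < 1], the derivative at [alpha]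
    does not depend on the values of [f] outside [0, 1]. *)
Record reaction_term (f : R -> R) (alpha : R) : Prop := ReactionTerm {
  reaction_cont : {within `[0, 1], continuous f} ;
  reaction_0 : f 0 = 0 ;
  reaction_1 : f 1 = 0 ;
  reaction_alpha_itv : 0 < alpha < 1 ;
  reaction_alpha : f alpha = 0 ;
  reaction_sign : forall s : R, 0 < s < 1 -> s != alpha -> 0 < f s * (s - alpha) ;
  reaction_int : 0 < \int[mu]_(s in `[0, 1]) f s ;
  reaction_derivable : derivable f alpha 1 ;
  reaction_deriv_gt0 : 0 < derive1 f alpha ;
  reaction_KPP : forall s : R, 0 <= s <= 1 ->
    `|f s| <= derive1 f alpha * `|s - alpha| ;
  reaction_lin : exists2 l : R, 0 < l &
    forall s : R, 0 <= s <= 1 -> - l * s <= f s /\ f s <= l * (1 - s)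
}.

Definition C2 (v : R -> R) : Prop :=
  [/\ forall x : R, derivable v x 1,
      forall x : R, derivable (derive1 v) x 1
    & continuous v^`(2)].

Definition critical_speed (f : R -> R) (alpha eps : R) : R :=
  2 * Num.sqrt (eps * derive1 f alpha).

Definition curv_flux (v : R -> R) (x : R) : R :=
  derive1 v x / Num.sqrt (1 + (derive1 v x) ^+ 2).

(** Strict monotonicity and the two limits force [alpha < v x < 1], so that
    [f] is only evaluated in [0, 1]. *)
Record critical_front (f : R -> R) (alpha eps : R) (v : R -> R) : Prop :=
  CriticalFront {
    front_C2 : C2 v ;
    front_eq : forall x : R,
      eps * derive1 (curv_flux v) x - critical_speed f alpha eps * derive1 v x
        + f (v x) = 0 ;
    front_incr : increasing_fun v ;
    front_ninfty : v x @[x --> -oo] --> alpha ;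
    front_pinfty : v x @[x --> +oo] --> (1 : R) ;
    front_norm : v 0 = (alpha + 1) / 2
  }.

Definition step_fun (alpha z : R) : R :=
  if z < 0 then alpha else if z == 0 then (alpha + 1) / 2 else 1.

Record test_function := TestFunction {
  test_fun :> R -> R ;
  test_smooth : forall (n : nat) (x : R), derivable test_fun^`(n) x 1 ;
  test_compact_support : compact (closure [set x | test_fun x != 0])
}.

Definition regular_distr (g : R -> R) (phi : test_function) : R :=
  \int[mu]_x (g x * phi x).

Definition dirac_distr (a : R) (phi : test_function) : R := phi a.

(** Weak-* convergence in D'(R), for distributions viewed as functionals on real
    test functions. *)
Definition distr_cvg (I : Type) (F : set_system I) (T : I -> test_function -> R)
    (S : test_function -> R) : Prop :=
  forall phi, T i phi @[i --> F] --> S phi.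

End Defs.

(* Main.v *)
(** Write the equation as [(eps * w - c * v)' = - f v], where [c] is the
    critical speed, [w] is the flux [v' / sqrt (1 + v' ^ 2)] and [|w| <= 1].
    By the mean value theorem, every interval [(a, b)] contains a point [x] with
    [(b - a) * |f (v x)| <= 2 * eps + c], and the right-hand side tends to [0]
    with [eps]. Since [f] is bounded away from [0] on every compact subinterval
    of [(alpha, 1)] and [v] is increasing with [v 0 = (alpha + 1) / 2], this
    forces [v d] towards [1] and [v (- d)] towards [alpha] for every [d > 0].
    Monotonicity makes the convergence uniform away from [0], and the
    nonnegative functions [v'], of total mass [1 - alpha], concentrate at [0]. *)
Require Import Defs.
From mathcomp Require Import ring lra.

Set Implicit Arguments.
Unset Strict Implicit.
Unset Printing Implicit Defensive.

Local Open Scope ring_scope.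
Local Open Scope classical_set_scope.

(** * Limits of increasing functions at infinity, and regularity of the curvature flux *)

Lemma derivable_continuous (R : realType) (g : R -> R) :
  (forall x, derivable g x 1) -> continuous g.
Proof. by move=> dg x; apply/differentiable_continuous/derivable1_diffP. Qed.

Lemma increasing_cvg_ninfty_lt (R : realType) (v : R -> R) (l x : R) :
  increasing_fun v -> v y @[y --> -oo] --> l -> l < v x.
Proof.
move=> vincr vl; have vlt := leW_mono vincr.
(* Limits preserve only large inequalities; the detour through [x - 1] makes the bound strict. *)
apply: (@le_lt_trans _ _ (v (x - 1))); last by rewrite vlt ltrBlDr ltrDl.
rewrite leNgt; apply/negP => lv.
have [M [_ HM]] : \forall y \near -oo, v y > v (x - 1) by exact: (cvgr_gt l).
have := HM (Num.min (M - 1) (x - 1)).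
rewrite gt_min ltrBlDr ltrDl ltr01 /= => /(_ isT).
by rewrite vlt lt_min ltxx andbF.
Qed.

Lemma increasing_cvg_pinfty_gt (R : realType) (v : R -> R) (l x : R) :
  increasing_fun v -> v y @[y --> +oo] --> l -> v x < l.
Proof.
move=> vincr vl; have vlt := leW_mono vincr.
apply: (@lt_le_trans _ _ (v (x + 1))); first by rewrite vlt ltrDl.
rewrite leNgt; apply/negP => lv.
have [M [_ HM]] : \forall y \near +oo, v y < v (x + 1) by exact: (cvgr_lt l).
have := HM (Num.max (M + 1) (x + 1)).
rewrite lt_max ltrDl ltr01 /= => /(_ isT).
by rewrite vlt gt_max ltxx andbF.
Qed.

(** The root dominates the modulus of the slope, so no a priori gradient estimate on the front is
    required. *)
Lemma normr_curv_flux_le1 (R : realType) (v : R -> R) (x : R) :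
  `|curv_flux v x| <= 1.
Proof.
rewrite /curv_flux; set p := derive1 v x.
have p0 : 0 < 1 + p ^+ 2 by rewrite ltr_pwDl// sqr_ge0.
rewrite normrM normfV (ger0_norm (sqrtr_ge0 _)) ler_pdivrMr ?sqrtr_gt0// mul1r.
by rewrite -sqrtr_sqr ler_sqrt// ?lerDr ?ler01// ltW.
Qed.

(** As [derive1] is total, the front equation does not by itself make the flux differentiable. Twice
    differentiability of [v] does, the root being taken of a positive number. *)
Lemma derivable_curv_flux (R : realType) (v : R -> R) (x : R) :
  derivable (derive1 v) x 1 -> derivable (curv_flux v) x 1.
Proof.
set p := derive1 v => dp.
have p0 : 0 < 1 + p x ^+ 2 by rewrite ltr_pwDl// sqr_ge0.
have ds : derivable (fun y => Num.sqrt (1 + p y ^+ 2)) x 1.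
  apply/derivable1_diffP.
  apply: (@differentiable_comp _ _ _ _ (fun y => 1 + p y ^+ 2)).
    have -> : (fun y => 1 + p y ^+ 2) = cst 1 + p * p by apply/funext.
    apply/derivable1_diffP.
    by apply: derivableD; [exact: derivable_cst|exact: derivableM].
  by apply/derivable1_diffP; have [] := is_derive1_sqrt p0.
have di : derivable (fun y => (Num.sqrt (1 + p y ^+ 2))^-1) x 1.
  by apply: derivableV => //; rewrite gt_eqF// sqrtr_gt0.
exact: (derivableM dp di).
Qed.

(** * Estimates on a single front *)

Section Front.
Context (R : realType) (f : R -> R) (alpha eps : R) (v : R -> R).
Context (hf : reaction_term f alpha) (eps0 : 0 < eps).
Context (hv : critical_front f alpha eps v).

Lemma front_bounds (x : R) : alpha < v x < 1.
Proof.
have [_ _ vincr vN vP _] := hv.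
by rewrite (increasing_cvg_ninfty_lt x vincr vN)
           (increasing_cvg_pinfty_gt x vincr vP).
Qed.

Lemma critical_speed_ge0 : 0 <= critical_speed f alpha eps.
Proof. by rewrite mulr_ge0// sqrtr_ge0. Qed.

Lemma front_small_reaction (a b : R) : a < b ->
  exists2 x, a < x < b &
    (b - a) * `|f (v x)| <= 2 * eps + critical_speed f alpha eps.
Proof.
move=> ab; set c := critical_speed f alpha eps.
have [[dv ddv _] veq vincr _ _ _] := hv.
pose G : R -> R := eps \*o curv_flux v - c \*o v.
have dG (x : R) : is_derive x 1 G (- f (v x)).
  have dw := derivable_curv_flux (ddv x).
  have dZ (r : R) (u : R -> R) : derivable u x 1 -> derivable (r \*o u) x 1.
    by move=> du; exact: (derivableM (derivable_cst r x 1) du).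
  have dew := dZ eps _ dw; have dcv := dZ c _ (dv x).
  apply: DeriveDef; first exact: (derivableB dew dcv).
  rewrite (deriveB dew dcv) (deriveMl _ dw) (deriveMl _ (dv x)) -!derive1E.
  by apply/eqP; rewrite -subr_eq0 opprK; apply/eqP/veq.
have cG : continuous G by apply: derivable_continuous => x; exact: ex_derive.
have [x] := MVT ab (fun x _ => dG x) (continuous_subspaceT cG).
rewrite in_itv/= => xab GE; exists x => //.
have ba0 : 0 <= b - a by rewrite subr_ge0 ltW.
rewrite -[b - a]ger0_norm// -normrM mulrC -normrN -mulNr -GE /G /=.
have ewa := normr_curv_flux_le1 v a; have ewb := normr_curv_flux_le1 v b.
have /andP[ava va1] := front_bounds a.
have /andP[avb vb1] := front_bounds b.
have /andP[alpha0 alpha1] := reaction_alpha_itv hf.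
have c0 : 0 <= c := critical_speed_ge0.
(* Two flux values of modulus at most 1 give [2 * eps]; the increment of [v] is below 1, as its
   values lie between [alpha] and 1, and gives [c]. *)
have -> : eps * curv_flux v b - c * v b - (eps * curv_flux v a - c * v a) =
    eps * (curv_flux v b - curv_flux v a) - c * (v b - v a) by ring.
apply: (le_trans (ler_normB _ _)).
rewrite (normrM eps) (normrM c) (gtr0_norm eps0) (ger0_norm c0).
rewrite (mulrC 2); apply: lerD.
  rewrite ler_wpM2l ?(ltW eps0)//.
  by apply: (le_trans (ler_normB _ _)); rewrite -[2]/(1 + 1) lerD.
by rewrite ler_piMr// ler_norml; apply/andP; split; lra.
Qed.

End Front.

(** The minimum over the compact interval is attained, at a point where the sign condition applies.
    The bound depends on [f] alone, hence is uniform in [eps]. *)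
Lemma reaction_bounded_below (R : realType) (f : R -> R) (alpha p q : R) :
  reaction_term f alpha -> alpha < p -> p <= q -> q < 1 ->
  exists2 m, 0 < m & forall s, p <= s <= q -> m <= f s.
Proof.
move=> hf ap pq q1; have /andP[alpha0 alpha1] := reaction_alpha_itv hf.
have cf : {within `[p, q], continuous f}.
  apply: continuous_subspaceW (reaction_cont hf) => x /=.
  by rewrite !in_itv/= => /andP[? ?]; apply/andP; split; lra.
have [s] := EVT_min pq cf; rewrite in_itv/= => /andP[ps sq] fmin.
exists (f s) => [|u pu]; last by apply: fmin; rewrite in_itv.
rewrite -(@pmulr_lgt0 _ (s - alpha)); last by rewrite subr_gt0; lra.
by apply: (reaction_sign hf); [apply/andP; split; lra|rewrite gt_eqF//; lra].
Qed.

Lemma cvg_front_error (R : realType) (f : R -> R) (alpha : R) :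
  2 * eps + critical_speed f alpha eps @[eps --> 0^'+] --> (0 : R).
Proof.
(* [Num.sqrt] vanishes on negative numbers and is continuous on the whole line, so two-sided
   continuity at 0 suffices. *)
apply: cvg_at_right_filter.
have E0 : 2 * 0 + critical_speed f alpha 0 = 0.
  by rewrite /critical_speed mul0r sqrtr0 !mulr0 addr0.
rewrite -[X in _ --> X]E0; apply: cvgD.
  by apply: cvgM; [exact: cvg_cst|exact: cvg_id].
apply: cvgM; first exact: cvg_cst.
apply: continuous_cvg; first exact: sqrt_continuous.
by apply: cvgM; [exact: cvg_id|exact: cvg_cst].
Qed.

(** * Convergence away from the origin *)

Section Limit.
Context (R : realType) (f : R -> R) (alpha : R) (hf : reaction_term f alpha).
Context (V : R -> R -> R).
Context (hV : forall eps : R, 0 < eps -> critical_front f alpha eps (V eps)).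

Lemma front_transition_layer (d t : R) : 0 < d -> 0 < t ->
  \forall eps \near 0^'+, 1 - t < V eps d /\ V eps (- d) < alpha + t.
Proof.
move=> d0 t0; have /andP[alpha0 alpha1] := reaction_alpha_itv hf.
set h := (alpha + 1) / 2.
(* Comparing with [h] keeps [[p, q]] a nonempty interval inside [(alpha, 1)] however large [t] is,
   and puts the value at 0 in it. *)
pose p := Num.min h (alpha + t); pose q := Num.max h (1 - t).
have ah : alpha < h by rewrite /h; lra.
have h1 : h < 1 by rewrite /h; lra.
have [m m0 fm] : exists2 m, 0 < m & forall s, p <= s <= q -> m <= f s.
  apply: reaction_bounded_below hf _ _ _.
  - by rewrite lt_min ah ltrDl.
  - by rewrite ge_min le_max lexx.
  - by rewrite gt_max h1 ltrBlDr ltrDl.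
(* A front cannot stay in the band [[p, q]] over a length [d]. Failure at [d] would trap it there on
   [[0, d]], failure at [- d] on [[- d, 0]]. *)
have layer eps a b : 0 < eps -> a < b -> d = b - a ->
    2 * eps + critical_speed f alpha eps < d * m ->
    p <= V eps a -> V eps b <= q -> False.
  move=> eps0 ab dE small pa bq.
  have [x /andP[ax xb]] := front_small_reaction hf eps0 (hV eps0) ab.
  rewrite -dE => fx; have [_ _ vincr _ _ _] := hV eps0.
  have : d * m <= d * `|f (V eps x)|.
    rewrite ler_pM2l// (le_trans _ (ler_norm _))// fm//.
    by rewrite (le_trans pa) ?(le_trans _ bq)// vincr ltW.
  by move=> /le_trans /(_ fx); rewrite leNgt small.
near=> eps.
have eps0 : 0 < eps by [].
have small : 2 * eps + critical_speed f alpha eps < d * m.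
  near: eps; apply: (cvgr_lt 0 (@cvg_front_error R f alpha)).
  exact: mulr_gt0.
have [_ _ _ _ _ v0] := hV eps0.
split; rewrite ltNge; apply/negP => far.
- apply: (layer eps 0 d) => //; first by rewrite subr0.
    by rewrite v0 ge_min lexx.
  by rewrite le_max far orbT.
- apply: (layer eps (- d) 0) => //; first by rewrite oppr_lt0.
  + by rewrite sub0r opprK.
  + by rewrite ge_min far orbT.
  + by rewrite v0 le_max lexx.
Unshelve. all: by end_near. Qed.

Lemma front_uniform_cvg (d t : R) : 0 < d -> 0 < t ->
  \forall eps \near 0^'+,
    forall z, d <= `|z| -> `|step_fun alpha z - V eps z| < t.
Proof.
move=> d0 t0; near=> eps => z.
have eps0 : 0 < eps by [].
have [_ _ vincr _ _ _] := hV eps0.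
have /andP[avz vz1] := front_bounds (hV eps0) z.
have [right left] : 1 - t < V eps d /\ V eps (- d) < alpha + t.
  by near: eps; exact: front_transition_layer.
rewrite /step_fun; have [z0|z0|->] := ltgtP z 0; last by rewrite normr0 leNgt d0.
  rewrite ltr0_norm// lerNr => zd.
  have vzd : V eps z <= V eps (- d) by rewrite vincr.
  by rewrite ltr_norml; apply/andP; split; lra.
rewrite gtr0_norm// => zd.
have vzd : V eps d <= V eps z by rewrite vincr.
by rewrite ltr_norml; apply/andP; split; lra.
Unshelve. all: by end_near. Qed.

End Limit.

(** * Integrals against a nonnegative derivative, and against a compactly supported function *)

Lemma Rintegral_derive1_mul_near_cst (R : realType) (v g : R -> R) (a b k B : R) :
  a < b -> (forall x, derivable v x 1) -> continuous (derive1 v) ->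
  (forall x, 0 <= derive1 v x) -> continuous g ->
  (forall x, a <= x <= b -> `|g x - k| <= B) ->
  `|\int[lebesgue_measure]_(x in `[a, b]) (derive1 v x * g x) -
    k * (v b - v a)| <= B * (v b - v a).
Proof.
move=> ab dv cdv dv0 cg gB; set mu := @lebesgue_measure R.
have intc (u : R -> R) : continuous u -> mu.-integrable `[a, b] (EFin \o u).
  move=> cu; apply: continuous_compact_integrable; first exact: segment_compact.
  exact: continuous_subspaceT.
have cv := derivable_continuous dv.
have FTC : \int[mu]_(x in `[a, b]) derive1 v x = v b - v a.
  have dvab : derivable_oo_LRcontinuous v a b.
    split=> [x _||]; [exact: dv| |].
      by apply: cvg_at_right_filter; exact: cv.
    by apply: cvg_at_left_filter; exact: cv.
  have := continuous_FTC2 ab (continuous_subspaceT cdv) dvab (fun x _ => erefl).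
  by rewrite /Rintegral => ->.
have cdvg : continuous (fun x => derive1 v x * g x).
  by move=> x; apply: cvgM; [exact: cdv|exact: cg].
have cst_mul r : \int[mu]_(x in `[a, b]) (r * derive1 v x) = r * (v b - v a).
  by rewrite RintegralZl// ?FTC//; exact: intc.
have cr r : continuous (fun x => r * derive1 v x).
  by move=> x; apply: cvgM; [exact: cvg_cst|exact: cdv].
(* Since [v'] is nonnegative, the bounds [k - B] and [k + B] on [g] survive multiplication by [v']
   and integration. *)
have lo : (k - B) * (v b - v a) <= \int[mu]_(x in `[a, b]) (derive1 v x * g x).
  rewrite -cst_mul; apply: le_Rintegral => //; [exact: intc|exact: intc|].
  move=> x /=; rewrite in_itv/= => /gB; rewrite ler_norml => /andP[? ?].
  by rewrite mulrC ler_wpM2l//; lra.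
have hi : \int[mu]_(x in `[a, b]) (derive1 v x * g x) <= (k + B) * (v b - v a).
  rewrite -cst_mul; apply: le_Rintegral => //; [exact: intc|exact: intc|].
  move=> x /=; rewrite in_itv/= => /gB; rewrite ler_norml => /andP[? ?].
  by rewrite [leRHS]mulrC ler_wpM2l//; lra.
move: lo hi; rewrite mulrBl mulrDl ler_norml => lo hi.
by rewrite lerBrDr addrC lo lerBlDr addrC.
Qed.

Lemma Rintegral_itv_split (R : realType) (g : R -> R) (a b c : R) :
  continuous g -> a <= b -> b <= c ->
  \int[lebesgue_measure]_(x in `[a, c]) g x =
  \int[lebesgue_measure]_(x in `[a, b]) g x +
  \int[lebesgue_measure]_(x in `[b, c]) g x.
Proof.
move=> cg ab bc; set mu := @lebesgue_measure R.
have intg p q : mu.-integrable `[p, q] (EFin \o g).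
  apply: continuous_compact_integrable; first exact: segment_compact.
  exact: continuous_subspaceT.
(* Removing [[a, b]] from [[a, c]] leaves []b, c]]; the missing endpoint is a null set. *)
rewrite -(@Rintegral_itv_obnd_cbnd _ b); last first.
  apply: integrableS (intg b c) => // x /=; rewrite !in_itv/=.
  by move=> /andP[/ltW -> ->].
rewrite -(@Rintegral_itvB _ g (BLeft a) (BRight c) b) ?bnd_simp//.
by rewrite addrC subrK.
Qed.

(** [M] is chosen before [g], so one truncation will serve the derivatives of all fronts. *)
Lemma Rintegral_compact_support (R : realType) (h : R -> R) :
  compact (closure [set x | h x != 0]) ->
  exists2 M : R, 0 < M & forall (K : R) (g : R -> R), M <= K ->
    \int[lebesgue_measure]_x (g x * h x) =
    \int[lebesgue_measure]_(x in `[- K, K]) (g x * h x).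
Proof.
(* Only numbers strictly above [M0] are known to be bounds, and [M0] may be negative. *)
move=> /compact_bounded [M0 [_ HM0]]; pose M := `|M0| + 1.
have M_gt0 : 0 < M by rewrite ltr_wpDl.
exists M => // K g MK; rewrite [RHS]Rintegral_mkcond.
apply: eq_Rintegral => x _; rewrite /patch; case: ifPn => //.
rewrite notin_setE /= in_itv/= => xK; have [->|hx] := eqVneq (h x) 0.
  by rewrite mulr0.
exfalso; apply: xK; rewrite -ler_norml (le_trans _ MK)//.
apply: HM0; last exact: subset_closure.
by rewrite (le_lt_trans (ler_norm M0))// ltrDl.
Qed.

(** * Concentration of the derivatives at the origin *)

Section Distribution.
Context (R : realType) (f : R -> R) (alpha : R) (hf : reaction_term f alpha).
Context (V : R -> R -> R).
Context (hV : forall eps : R, 0 < eps -> critical_front f alpha eps (V eps)).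

Lemma front_derive1_dirac (phi : @test_function R) :
  regular_distr (derive1 (V eps)) phi @[eps --> 0^'+] --> (1 - alpha) * phi 0.
Proof.
have dphi : continuous phi := derivable_continuous (@test_smooth R phi 0).
have [M M0 intM] := Rintegral_compact_support (@test_compact_support R phi).
have /andP[alpha0 alpha1] := reaction_alpha_itv hf.
apply/cvgrPdist_lt => t t0.
have [d d0 phid] : exists2 d : R, 0 < d &
    forall x, `|x| <= d -> `|phi x - phi 0| <= t / 2.
  have /cvgrPdist_le/(_ (t / 2) (divr_gt0 t0 (ltr0Sn _ 1))) := dphi 0.
  move=> /nbhs_ballP[e /= e0 He]; exists (e / 2); first exact: divr_gt0.
  move=> x xe; rewrite distrC; apply: He.
  by rewrite /ball/= sub0r normrN (le_lt_trans xe)// ltr_pdivrMr// ltr_pMr// ltr1n.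
pose K := M + d.
have dK : d < K by rewrite ltrDr.
have [B B0 phiB] : exists2 B : R, 0 <= B & forall x, - K <= x <= K -> `|phi x| <= B.
  have KK : - K <= K by lra.
  have cn : {within `[- K, K], continuous (fun x => `|phi x|)}.
    apply: continuous_subspaceT => x.
    by apply: cvg_norm; exact: dphi.
  have [c _ Hc] := EVT_max KK cn.
  by exists `|phi c| => // x xK; apply: Hc; rewrite in_itv.
(* The two tails and the mass outside [[- K, K]] will cost [2 * B * th] each, in all less than
   [t / 2]; [B + 1] covers [B = 0]. *)
pose th := t / (12 * (B + 1)).
have th0 : 0 < th by rewrite divr_gt0// mulr_gt0// ltr_wpDl.
have thE : 12 * (B * th) + 12 * th = t.
  by rewrite /th; field; rewrite gt_eqF// ltr_wpDl.
near=> eps.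
have eps0 : 0 < eps by [].
have [right left] : 1 - th < V eps d /\ V eps (- d) < alpha + th.
  by near: eps; exact: (front_transition_layer hf hV).
have [[dv ddv _] _ vincr _ _ _] := hV eps0.
have vbounds := front_bounds (hV eps0).
set v := V eps in right left dv ddv vincr vbounds *.
have cdv := derivable_continuous ddv.
have dv0 x : 0 <= derive1 v x.
  apply: (@incr_derive1_ge0 _ v setT); rewrite ?interiorT//.
  by move=> y z _ _; rewrite (leW_mono vincr).
have near_cst a b Bab (ab : a < b) :=
  @Rintegral_derive1_mul_near_cst R v phi a b (phi 0) Bab ab dv cdv dv0 dphi.
have phi_osc x : - K <= x <= K -> `|phi x - phi 0| <= 2 * B.
  move=> xK; rewrite (le_trans (ler_normB _ _))// mulr2n mulrDl mul1r.
  by rewrite lerD// phiB//; apply/andP; split; lra.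
have vphi : continuous (fun x => derive1 v x * phi x).
  by move=> x; apply: cvgM; [exact: cdv|exact: dphi].
rewrite /regular_distr (intM K); last by rewrite lerDl ltW.
(* On the core [[- d, d]] the test function is close to [phi 0]; on the tails it is only bounded,
   but [v'] has mass at most [th]. *)
rewrite (@Rintegral_itv_split _ _ (- K) (- d) K) //; [|lra|lra].
rewrite (@Rintegral_itv_split _ _ (- d) d K) //; [|lra|lra].
set I1 := Rintegral _ _ _; set I2 := Rintegral _ _ _; set I3 := Rintegral _ _ _.
have /andP[vK0 vK1] := vbounds K; have /andP[vNK0 vNK1] := vbounds (- K).
have /andP[vd0 vd1] := vbounds d; have /andP[vNd0 vNd1] := vbounds (- d).
have vNKd : v (- K) <= v (- d) by rewrite vincr; lra.
have vdK : v d <= v K by rewrite vincr; lra.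
have vNdd : v (- d) <= v d by rewrite vincr; lra.
have e1 : `|I1 - phi 0 * (v (- d) - v (- K))| <= 2 * B * th.
  apply: le_trans (near_cst _ _ (2 * B) _ _) _; first lra.
    by move=> x /andP[? ?]; apply: phi_osc; apply/andP; split; lra.
  by apply: ler_wpM2l; [exact: mulr_ge0|lra].
have e2 : `|I2 - phi 0 * (v d - v (- d))| <= t / 2.
  apply: le_trans (near_cst _ _ (t / 2) _ _) _; first lra.
    by move=> x xd; apply: phid; rewrite ler_norml.
  by apply: ler_piMr; lra.
have e3 : `|I3 - phi 0 * (v K - v d)| <= 2 * B * th.
  apply: le_trans (near_cst _ _ (2 * B) _ _) _; first lra.
    by move=> x /andP[? ?]; apply: phi_osc; apply/andP; split; lra.
  by apply: ler_wpM2l; [exact: mulr_ge0|lra].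
have e0 : `|phi 0 * ((1 - v K) + (v (- K) - alpha))| <= B * (2 * th).
  rewrite normrM; apply: ler_pM => //; first by apply: phiB; apply/andP; split; lra.
  by rewrite ger0_norm; lra.
(* The increments of [v] over the three pieces and the mass outside [[- K, K]] add up to
   [1 - alpha]. *)
have -> : (1 - alpha) * phi 0 - (I1 + (I2 + I3)) =
    phi 0 * ((1 - v K) + (v (- K) - alpha)) -
    (I1 - phi 0 * (v (- d) - v (- K))) - (I2 - phi 0 * (v d - v (- d))) -
    (I3 - phi 0 * (v K - v d)) by ring.
apply: (@le_lt_trans _ _ (B * (2 * th) + 2 * B * th + t / 2 + 2 * B * th)).
  do 3![apply: (le_trans (ler_normB _ _)); apply: lerD => //].
lra.
Unshelve. all: by end_near. Qed.

End Distribution.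

Theorem theorem3p3 (R : realType) (f : R -> R) (alpha : R)
    (hf : reaction_term f alpha)
    (V : R -> R -> R)
    (hV : forall eps : R, 0 < eps -> critical_front f alpha eps (V eps)) :
  [/\ forall z : R, V eps z @[eps --> 0^'+] --> step_fun alpha z,
      forall I0 : set R, nbhs (0 : R) I0 ->
        {uniform ~` I0, V @ 0^'+ --> step_fun alpha}
    & distr_cvg (0^'+) (fun eps : R => regular_distr (derive1 (V eps)))
        (fun phi => (1 - alpha) * dirac_distr 0 phi)].
Proof.
split.
- move=> z; have [->|z0] := eqVneq z 0.
    (* At the origin the normalization makes the family constant for [eps > 0]. *)
    apply: cvg_near_cst.
    rewrite /step_fun ltxx eqxx; near=> eps.
    have eps0 : 0 < eps by [].
    by have [] := hV eps eps0.
  apply/cvgrPdist_lt => t t0; near=> eps.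
  have H : forall y, `|z| <= `|y| -> `|step_fun alpha y - V eps y| < t.
    by near: eps; apply: (front_uniform_cvg hf hV _ t0); rewrite normr_gt0.
  exact: H.
- move=> I0 /nbhs_ballP [d /= d0 dI0] P /uniform_nbhs [E [entE EP]].
  (* Every entourage contains a metric one, which turns uniform convergence into a bound by [t] on
     [d <= |z|]. *)
  have [t /= t0 tE] : exists2 t : R, 0 < t & [set xy | ball xy.1 t xy.2] `<=` E.
    by move: entE; rewrite -entourage_ballE => -[t]; exists t.
  have := front_uniform_cvg hf hV d0 t0; apply: filterS => eps H.
  apply: EP => z zI0; apply: tE; apply: H.
  rewrite leNgt; apply/negP => zd; apply: zI0; apply: dI0.
  by rewrite /ball/= sub0r normrN.
- by move=> phi; exact: (front_derive1_dirac hf hV).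
Unshelve. all: by end_near. Qed.
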